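(* If $n\in\mathbb{N}$ and $\alpha\in\bar{\mathbb{Q}}$ satisfy $H^n(\alpha)=\alpha$, then $\alpha=a^b$ for some $a\in\mathbb{N}$ and rational $b>0$, and $H(\alpha)=\alpha$. Conversely, $H(a^b)=a^b$ for all $a\in\mathbb{N}$ and rational $b>0$ (here $a^b$ denotes the positive real power).
   Context: $\bar{\mathbb{Q}}$ is the algebraic closure of $\mathbb{Q}$ in $\mathbb{C}$. $H:\bar{\mathbb{Q}}\to\bar{\mathbb{Q}}\cap[1,\infty)$ is the absolute multiplicative Weil height: for $\alpha$ of degree $d$ with $a_0>0$ the leading coefficient of a minimal polynomial of $\alpha$ in $\mathbb{Z}[t]$ and conjugates $\alpha_1,\dots,\alpha_d$, $H(\alpha)=\big(a_0\prod_i\max\{1,|\alpha_i|\}\big)^{1/d}$. Iterates: $H^0=\mathrm{id}$, $H^n=H\circ H^{n-1}$. *)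

(* Defs.v *)
From HB Require Import structures.
From mathcomp Require Import all_boot all_order all_algebra all_field.
Set Implicit Arguments. Unset Strict Implicit. Unset Printing Implicit Defensive.
Import Order.TTheory GRing.Theory Num.Theory.
Local Open Scope ring_scope.

Definition minQpoly (x : algC) : {poly rat} := sval (minCpolyP x).

Definition alg_deg (x : algC) : nat := (size (minQpoly x)).-1.

(* An integer multiple of minQpoly x: clear denominators. *)
Definition minZpoly_raw (x : algC) : {poly int} :=
  let p := minQpoly x in
  let D : int := \prod_(i < size p) denq p`_i in
  \poly_(i < size p) numq (D%:~R * p`_i).

(* The minimal polynomial of x in Z[t]: primitive, positive leading coefficient. *)
Definition minZpoly (x : algC) : {poly int} := zprimitive (minZpoly_raw x).

Definition lead_minZ (x : algC) : int := lead_coef (minZpoly x).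

Definition conjugates (x : algC) : seq algC :=
  sval (closed_field_poly_normal (minCpoly x)).

(* Absolute multiplicative Weil height. The d-th root of a nonnegative real
   algebraic number is its nonnegative real d-th root. *)
Definition weilH (x : algC) : algC :=
  (alg_deg x).-root ((lead_minZ x)%:~R * \prod_(z <- conjugates x) Num.max 1 `|z|).

(* a^b for a natural number a and a positive rational b, as the positive
   real power: the (denq b)-th nonnegative real root of a^(numq b). *)
Definition natratpow (a : nat) (b : rat) : algC :=
  (`|denq b|%N).-root ((a%:R : algC) ^+ `|numq b|%N).

(* Main.v *)
(* The Mahler measure M = a_0 prod max(1, |alpha_i|) of alpha is the modulus of
   P = a_0 prod_(|alpha_i| > 1) alpha_i, an algebraic integer all of whose
   conjugates have modulus at most M; since M^2 = P * conj P, the same holds for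
   M, and then for its root beta = H(alpha): it is an algebraic integer, at
   least 1, with all its conjugates in the disc of radius beta.  Hence
   H(beta) <= beta, with equality iff max(1, |z|) = beta for every conjugate z
   of beta.  So H is nonincreasing on its image, a periodic point alpha is
   fixed, and either alpha = 1 or all its d conjugates have modulus alpha; in
   the latter case alpha^d is the absolute value of the norm of alpha, a natural
   number. *)
Require Import Defs.
From HB Require Import structures.
From mathcomp Require Import all_boot all_order all_algebra all_field.
Import Order.TTheory GRing.Theory Num.Theory.
Local Open Scope ring_scope.

(** * Integrality of products of roots *)

(** Transitivity of integrality: each coefficient is integral over the integers through its own
    [minCpoly]. *)
Lemma Aint_root_monic (p : {poly algC}) (x : algC) :
  p \is monic -> p \is a polyOver Aint -> root p x -> x \in Aint.
Proof.
move=> mon_p /polyOverP Ap px0.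
have int_Aint y : y \in Aint -> integralOver (intr : int -> algC) y.
  move=> Ay; have /floorpP[q Dq] : minCpoly y \is a polyOver Num.int by [].
  exists q; last by rewrite -Dq root_minCpoly.
  have := monicP (minCpoly_monic y).
  rewrite Dq lead_coef_map_inj //; last exact: intr_inj.
  by rewrite -[RHS](rmorph1 (intr : int -> algC)) => /intr_inj/monicP.
have [] := @integral_root_monic int algC intr x p mon_p px0.
  by move=> y /(nthP 0)[i _ <-]; apply: int_Aint.
move=> q mon_q qx0; apply: (root_monic_Aint qx0); first exact: monic_map.
by apply/polyOverP=> i; rewrite coef_map rpred_int.
Qed.

(* With c the leading coefficient and n the degree of p, the polynomial
   c^(n-1) p(t / c) is monic over Aint and has root c z. *)
Lemma Aint_lead_coef_root (p : {poly algC}) (z : algC) :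
  p \is a polyOver Aint -> root p z -> lead_coef p * z \in Aint.
Proof.
move=> /polyOverP Ap pz0; have [->|nz_p] := eqVneq p 0.
  by rewrite lead_coef0 mul0r.
set c := lead_coef p; pose n := (size p).-2.
have sz_p : size p = n.+2.
  by rewrite /n -subn2 -[RHS]/(2 + _)%N subnKC // (root_size_gt1 nz_p pz0).
pose q := 'X^(n.+1) + \poly_(i < n.+1) (p`_i * c ^+ (n - i)).
apply: (@Aint_root_monic q).
- rewrite monicE lead_coefDl ?lead_coefXn // size_polyXn ltnS; exact: size_poly.
- apply: rpredD; first by apply/polyOverP=> i; rewrite coefXn; case: eqP.
  apply/polyOverP=> i; rewrite coef_poly; case: ifP => // _.
  by rewrite rpredM ?rpredX //; apply: Ap.
- rewrite rootE hornerD hornerXn horner_poly.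
  have -> : (c * z) ^+ n.+1 = c ^+ n * (p`_n.+1 * z ^+ n.+1).
    by rewrite /c lead_coefE sz_p /= exprMn mulrA exprSr.
  have -> : \sum_(i < n.+1) p`_i * c ^+ (n - i) * (c * z) ^+ i =
            c ^+ n * \sum_(i < n.+1) p`_i * z ^+ i.
    rewrite mulr_sumr; apply: eq_bigr => i _.
    have -> : c ^+ n = c ^+ (n - i) * c ^+ i by rewrite -exprD subnK // -ltnS.
    by rewrite exprMn [p`_i * _]mulrC -!mulrA [p`_i * _]mulrCA.
  move: pz0; rewrite rootE horner_coef sz_p big_ord_recr /= => /eqP pz0.
  by rewrite -mulrDr addrC pz0 mulr0.
Qed.

(* Induction on the degree: if c t^m is the leading term of q, subtracting
   c t^m (t - z) from q (t - z) keeps the coefficients integral, since c z is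
   an algebraic integer. *)
Lemma polyOver_Aint_divXsubC (q : {poly algC}) (z : algC) :
  q * ('X - z%:P) \is a polyOver Aint -> q \is a polyOver Aint.
Proof.
have [n] := ubnP (size q).
elim: n q => [|n IHn] q; rewrite ?ltn0 ?ltnS // => sz_q Aqz.
have [->|nz_q] := eqVneq q 0; first exact: rpred0.
set c := lead_coef q; pose m := (size q).-1.
have lqz : lead_coef (q * ('X - z%:P)) = c.
  by rewrite lead_coef_Mmonic ?monicXsubC.
have Ac : c \in Aint by rewrite -lqz lead_coefE (polyOverP Aqz).
have Acz : c * z \in Aint.
  by rewrite -lqz Aint_lead_coef_root // rootM root_XsubC eqxx orbT.
have AXn k : 'X^k \is a polyOver Aint.
  by apply/polyOverP=> i; rewrite coefXn; case: eqP.
have AcXn : c *: 'X^m \is a polyOver Aint by rewrite polyOverZ.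
rewrite -[q](subrK (c *: 'X^m)) rpredD //; apply: IHn.
  apply: leq_trans sz_q; rewrite [size q]polySpred // ltnS.
  apply/leq_sizeP => j; rewrite leq_eqVlt coefB coefZ coefXn.
  case/predU1P=> [<- | ltmj].
    by rewrite eqxx mulr1 subrr.
  rewrite gtn_eqF // mulr0 subr0 nth_default //.
  by rewrite [size q]polySpred.
rewrite mulrBl rpredB // mulrBr -scalerAl -exprSr -scalerAl mulrC mul_polyC.
by rewrite scalerA rpredB // polyOverZ.
Qed.

(** The cofactor [p] carries the induction: a kept linear factor is absorbed into it, a discarded
    one is divided out. *)
Lemma polyOver_Aint_prod_XsubC_filter (P : pred algC) p (s : seq algC) :
    p * \prod_(z <- s) ('X - z%:P) \is a polyOver Aint ->
  p * \prod_(z <- s | P z) ('X - z%:P) \is a polyOver Aint.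
Proof.
elim: s p => [|z s IHs] p; first by rewrite !big_nil.
rewrite !big_cons; case: ifP => _; first by rewrite !mulrA; apply: IHs.
by rewrite [('X - _) * _]mulrC mulrA => /polyOver_Aint_divXsubC; apply: IHs.
Qed.

(** Up to sign, this number is the constant coefficient once the factors outside [P] are divided
    out. *)
Lemma Aint_scale_prod_roots (P : pred algC) c (s : seq algC) :
    c *: \prod_(z <- s) ('X - z%:P) \is a polyOver Aint ->
  c * \prod_(z <- s | P z) z \in Aint.
Proof.
rewrite -mul_polyC => /(polyOver_Aint_prod_XsubC_filter P)/polyOverP/(_ 0).
rewrite coefCM -big_filter coef0_prod_XsubC mulrCA => A.
rewrite -big_filter -[_ * _](signrMK (size (filter P s))).
by rewrite rpredM ?rpredX ?rpredN.
Qed.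

(** * Conjugates as images under automorphisms *)

(** The roots generate a splitting field [Qs]; sending [x] to [z] extends from the simple extension
    to [Qs], and from there to [algC]. *)
Lemma minCpoly_root_aut (x z : algC) : root (minCpoly x) z ->
  exists nu : {rmorphism algC -> algC}, nu x = z.
Proof.
move=> px_z; have [r Dr] := closed_field_poly_normal (minCpoly x).
rewrite (monicP (minCpoly_monic x)) scale1r in Dr.
have [Qs [QsC [s1 Ds1 genQs]]] := num_field_exists r.
have inQs y : y \in r -> exists yy, QsC yy = y.
  by rewrite -Ds1 => /mapP[yy _ ->]; exists yy.
have [xx Dx] : exists xx, QsC xx = x.
  by apply: inQs; rewrite -root_prod_XsubC -Dr root_minCpoly.
have [zz Dz] : exists zz, QsC zz = z.
  by apply: inQs; rewrite -root_prod_XsubC -Dr.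
have [p [Dp mon_p] dv_p] := minCpolyP x.
pose pr := map_poly (in_alg Qs) p.
have Dpr : map_poly QsC pr = minCpoly x.
  rewrite Dp -map_poly_comp; apply: eq_map_poly => a.
  by rewrite /= rmorphZ_num rmorph1 mulr1.
have Qpr : pr \is a polyOver 1%VS.
  by apply/polyOverP=> i; rewrite coef_map memvZ ?memv_line.
have splitQs : splittingFieldFor 1 pr fullv.
  exists s1 => //; congr (_ %= _): (eqpxx pr); apply/(map_poly_inj QsC).
  rewrite Dpr Dr -Ds1 big_map rmorph_prod /=; apply: eq_bigr => y _.
  by rewrite map_polyXsubC.
have homQs1 : kHom 1 1 (\1%VF : 'End(Qs)) by rewrite kHom1.
have [q1 Dq1] : exists q1, minPoly 1 xx = map_poly (in_alg Qs) q1.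
  have aP i : (minPoly 1 xx)`_i \in 1%VS by apply/polyOverP; apply: minPolyOver.
  have{aP} a_ i := sig_eqW (vlineP _ _ (aP i)).
  exists (\poly_(i < size (minPoly 1 xx)) sval (a_ i)).
  apply/polyP=> i; rewrite coef_map coef_poly /=.
  case: ltnP => [_|/(nth_default 0) ->]; last by rewrite scale0r.
  by case: (a_ i).
have QsCq : map_poly QsC (map_poly (in_alg Qs) q1) = map_poly ratr q1.
  rewrite -map_poly_comp; apply: eq_map_poly => a.
  by rewrite /= rmorphZ_num rmorph1 mulr1.
(* The rational polynomial [q1] vanishes at [x], so [p] divides it and it vanishes at [z] too. *)
have root_zz : root (map_poly \1%VF (minPoly 1 xx)) zz.
  rewrite (@eq_map_poly _ _ _ id) => [|a]; last by rewrite id_lfunE.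
  rewrite map_poly_id // -(fmorph_root QsC) Dz Dq1 QsCq.
  have : root (map_poly ratr q1) x.
    by rewrite -QsCq -Dq1 -Dx fmorph_root root_minPoly.
  by rewrite dv_p => /dvdpP[q2 ->]; rewrite rmorphM rootM /= -Dp px_z orbT.
have homphi := kHomExtendP (subvv _) homQs1 root_zz.
have s1x : (1 <= <<1; xx>>)%VS by apply: subv_adjoin.
have splitQs' : splittingFieldFor <<1; xx>> pr fullv.
  exact: splittingFieldForS s1x (subvf _) splitQs.
have [f homf Df] := kHom_extends s1x homphi Qpr splitQs'.
pose fM := GRing.isMonoidMorphism.Build _ _ f (kHom_monoid_morphism homf).
pose phi : {rmorphism _ -> _} := HB.pack (fun_of_lfun f) fM.
have [nu Dnu] := extend_algC_subfield_aut QsC phi.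
exists nu; rewrite -Dx -Dnu /= -Df ?memv_adjoin //.
by rewrite -Dz; congr (QsC _); apply: (kHomExtend_val homQs1).
Qed.

Lemma minCpoly_conjugates (x : algC) :
  minCpoly x = \prod_(z <- conjugates x) ('X - z%:P).
Proof.
rewrite /conjugates; case: closed_field_poly_normal => r /= {1}->.
by rewrite (monicP (minCpoly_monic x)) scale1r.
Qed.

Lemma mem_conjugates (x z : algC) :
  reflect (exists nu : {rmorphism algC -> algC}, z = nu x) (z \in conjugates x).
Proof.
rewrite -root_prod_XsubC -minCpoly_conjugates.
apply: (iffP idP) => [/minCpoly_root_aut[nu <-] | [nu ->]]; first by exists nu.
by rewrite -(minCpoly_aut nu) root_minCpoly.
Qed.

(** [nu] fixes the rational coefficients of [minCpoly x], and the multiset of roots is determined by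
    the polynomial. *)
Lemma perm_conjugates_aut (nu : {rmorphism algC -> algC}) x :
  perm_eq (map nu (conjugates x)) (conjugates x).
Proof.
apply: prod_XsubC_eq; rewrite big_map -minCpoly_conjugates.
transitivity (map_poly nu (minCpoly x)).
  rewrite minCpoly_conjugates rmorph_prod /=.
  by apply: eq_bigr => z _; rewrite map_polyXsubC.
have [p [-> _] _] := minCpolyP x; rewrite -map_poly_comp.
by apply: eq_map_poly => a; apply: fmorph_rat.
Qed.

(** * Degree and leading coefficient of the integral minimal polynomial *)

Lemma minQpolyP (x : algC) :
  minCpoly x = map_poly ratr (minQpoly x) /\ minQpoly x \is monic.
Proof. by rewrite /minQpoly; case: (minCpolyP x) => p [? ?]. Qed.

Lemma size_conjugates (x : algC) : size (conjugates x) = alg_deg x.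
Proof.
have [Dp _] := minQpolyP x.
by rewrite /alg_deg -(size_map_poly (ratr : rat -> algC)) -Dp
   minCpoly_conjugates size_prod_XsubC.
Qed.

Lemma alg_deg_gt0 (x : algC) : (0 < alg_deg x)%N.
Proof.
have := size_minCpoly x.
by rewrite minCpoly_conjugates size_prod_XsubC size_conjugates.
Qed.

Lemma minZpoly_rawE (x : algC) : exists2 D : int, D != 0 &
  map_poly intr (minZpoly_raw x) = D%:~R *: minQpoly x.
Proof.
rewrite /minZpoly_raw; set p := minQpoly x; set D := \prod_(i < _) _.
exists D; first by apply/prodf_neq0 => i _; apply: denq_neq0.
apply/polyP=> i; rewrite coef_map coef_poly coefZ.
case: ltnP => [lt_i | /(nth_default 0)->]; last by rewrite mulr0.
rewrite /= numqK // /D (bigD1 (Ordinal lt_i)) //= rmorphM /=.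
by rewrite mulrAC [_ * p`_i]mulrC -numqE -rmorphM intr_int.
Qed.

Lemma map_minZpoly (x : algC) :
  map_poly intr (minZpoly x) = (lead_minZ x)%:~R *: minQpoly x.
Proof.
have [D nzD rawE] := minZpoly_rawE x; have [_ mon_p] := minQpolyP x.
set a := zcontents (minZpoly_raw x).
have {}rawE : a%:~R *: map_poly intr (minZpoly x) = D%:~R *: minQpoly x.
  by rewrite -rawE [in RHS](zpolyEprim (minZpoly_raw x)) map_polyZ.
have nz_a : a%:~R != 0 :> rat.
  apply: contra_neq nzD => a0; apply: (@intr_inj rat).
  have := congr1 lead_coef rawE.
  by rewrite a0 scale0r lead_coef0 lead_coefZ (monicP mon_p) mulr1.
have {}rawE : map_poly intr (minZpoly x) = (a%:~R^-1 * D%:~R) *: minQpoly x.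
  by rewrite -scalerA -rawE scalerA mulVf // scale1r.
rewrite rawE /lead_minZ -(lead_coef_map_inj (@intr_inj rat)) ?rmorph0 //.
by rewrite rawE lead_coefZ (monicP mon_p) mulr1.
Qed.

Lemma lead_minZ_gt0 (x : algC) : 0 < lead_minZ x.
Proof.
rewrite -sgz_gt0 /lead_minZ /minZpoly sgz_lead_primitive.
case: eqP => // raw0; have [D nzD] := minZpoly_rawE x.
have [_ mon_p] := minQpolyP x; rewrite raw0 rmorph0 => /esym/eqP.
by rewrite scaler_eq0 intr_eq0 (negPf nzD) (negPf (monic_neq0 mon_p)).
Qed.

(** The rational minimal polynomial already has integer coefficients; being monic, it is the
    primitive part of its nonzero multiples. *)
Lemma lead_minZ_Aint (x : algC) : x \in Aint -> lead_minZ x = 1.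
Proof.
move=> Ax; have [Dp mon_p] := minQpolyP x.
have /floorpP[q Dq] : minCpoly x \is a polyOver Num.int by [].
have qE : map_poly intr q = minQpoly x.
  apply: (map_poly_inj (ratr : {rmorphism rat -> algC})); rewrite -Dp Dq.
  by rewrite -map_poly_comp; apply: eq_map_poly => a; rewrite /= ratr_int.
have mon_q : q \is monic.
  apply/monicP/(@intr_inj rat); rewrite -lead_coef_map_inj ?rmorph0 //.
    by rewrite qE (monicP mon_p).
  exact: intr_inj.
have [D nzD rawE] := minZpoly_rawE x.
have -> : lead_minZ x = lead_coef (zprimitive (D *: q)).
  congr (lead_coef (zprimitive _)).
  apply: (map_inj_poly (@intr_inj rat) (rmorph0 _)).
  by rewrite rawE -qE map_polyZ.
by rewrite zprimitiveZ // zprimitive_monic // (monicP mon_q).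
Qed.

(** * The Mahler measure *)

Definition mahler (x : algC) : algC :=
  (lead_minZ x)%:~R * \prod_(z <- conjugates x) Num.max 1 `|z|.

Lemma weilHE x : weilH x = (alg_deg x).-root (mahler x). Proof. by []. Qed.

(** Since [algC] is only partially ordered, bounds on this maximum go through a case split. *)
Lemma max1_norm (z : algC) : Num.max 1 `|z| = if 1 < `|z| then `|z| else 1.
Proof. by []. Qed.

Lemma max1_norm_ge1 (z : algC) : 1 <= Num.max 1 `|z|.
Proof. by rewrite max1_norm; case: ifP => // /ltW. Qed.

Lemma max1_norm_ge (z : algC) : `|z| <= Num.max 1 `|z|.
Proof.
by rewrite max1_norm; case: ifP => // /negbT; rewrite real_ltNge ?negbK.
Qed.

Lemma prod_ge1 (s : seq algC) (F : algC -> algC) :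
  (forall z, z \in s -> 1 <= F z) -> 1 <= \prod_(z <- s) F z.
Proof.
elim: s => [|z s IHs] F1; first by rewrite big_nil.
rewrite big_cons mulr_ege1 ?F1 ?mem_head // IHs // => y sy.
by rewrite F1 // inE sy orbT.
Qed.

Lemma mahler_ge1 x : 1 <= mahler x.
Proof.
rewrite mulr_ege1 ?prod_ge1 // => [|z _]; last exact: max1_norm_ge1.
by rewrite ler1z -gtz0_ge1 lead_minZ_gt0.
Qed.

Definition mahler_part (x : algC) : algC :=
  (lead_minZ x)%:~R * \prod_(z <- conjugates x | 1 < `|z|) z.

Lemma norm_mahler_part x : `|mahler_part x| = mahler x.
Proof.
(* Turning the filter into a conditional factor gives the maximum by definition. *)
rewrite normrM normr_prod big_mkcond ger0_norm //.
by rewrite ler0z ltW ?lead_minZ_gt0.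
Qed.

Lemma mahler_part_Aint x : mahler_part x \in Aint.
Proof.
apply: Aint_scale_prod_roots; rewrite -minCpoly_conjugates.
have [-> _] := minQpolyP x.
rewrite -[_%:~R](ratr_int algC) -map_polyZ -map_minZpoly.
apply/polyOverP=> i; rewrite !coef_map /= ratr_int; exact: Aint_int.
Qed.

Lemma norm_aut_mahler_part (nu : {rmorphism algC -> algC}) x :
  `|nu (mahler_part x)| <= mahler x.
Proof.
rewrite rmorphM rmorph_int normrM rmorph_prod normr_prod ger0_norm; last first.
  by rewrite ler0z ltW ?lead_minZ_gt0.
apply: ler_wpM2l; first by rewrite ler0z ltW ?lead_minZ_gt0.
(* Reindexed along [nu], the bound compares factor by factor; a conjugate missing on the left
   contributes 1. *)
rewrite -[leRHS](perm_big _ (perm_conjugates_aut nu x)) big_map big_mkcond /=.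
apply: ler_prod => z _; case: ifP => _; rewrite ?normr_ge0 ?max1_norm_ge //.
by rewrite ler01 max1_norm_ge1.
Qed.

Lemma sqr_mahler x : mahler x ^+ 2 = mahler_part x * (mahler_part x)^*.
Proof. by rewrite -norm_mahler_part normCK. Qed.

Lemma Aint_exp_inv (x : algC) n : (0 < n)%N -> x ^+ n \in Aint -> x \in Aint.
Proof.
move=> n_gt0 Axn; apply: (@Aint_root_monic ('X^n - (x ^+ n)%:P)).
- exact: monicXnsubC.
- apply: rpredB; last by rewrite polyOverC.
  by apply/polyOverP=> i; rewrite coefXn; case: eqP.
- by rewrite rootE !hornerE subrr.
Qed.

Lemma mahler_Aint x : mahler x \in Aint.
Proof.
apply: (@Aint_exp_inv _ 2) => //; rewrite sqr_mahler rpredM //.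
  exact: mahler_part_Aint.
by rewrite (Aint_aut Num.conj_op) mahler_part_Aint.
Qed.

Lemma norm_aut_mahler (nu : {rmorphism algC -> algC}) x :
  `|nu (mahler x)| <= mahler x.
Proof.
have M0 : 0 <= mahler x by rewrite (le_trans ler01) ?mahler_ge1.
rewrite -(@ler_pXn2r _ 2) ?nnegrE ?normr_ge0 // -normrX -rmorphXn /=.
rewrite sqr_mahler rmorphM normrM -sqr_mahler expr2 ler_pM ?normr_ge0 //.
  exact: norm_aut_mahler_part.
(* Complex conjugation followed by [nu] is again a ring morphism, so the same bound covers the
   second factor. *)
exact: (norm_aut_mahler_part (nu \o Num.conj_op)).
Qed.

(** * Values of the height and its monotonicity *)

Lemma weilHX x : weilH x ^+ alg_deg x = mahler x.
Proof. by rewrite weilHE rootCK ?alg_deg_gt0. Qed.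

Lemma weilH_ge1 x : 1 <= weilH x.
Proof. by rewrite weilHE rootC_ge1 ?alg_deg_gt0 ?mahler_ge1. Qed.

Lemma weilH_Aint x : weilH x \in Aint.
Proof. by rewrite (Aint_exp_inv _ _ (alg_deg_gt0 x)) ?weilHX ?mahler_Aint. Qed.

Lemma norm_conjugates_weilH x z : z \in conjugates (weilH x) -> `|z| <= weilH x.
Proof.
case/mem_conjugates=> nu ->; have H0 := le_trans ler01 (weilH_ge1 x).
rewrite -(@ler_pXn2r _ (alg_deg x)) ?nnegrE ?normr_ge0 ?alg_deg_gt0 //.
by rewrite -normrX -rmorphXn /= weilHX norm_aut_mahler.
Qed.

Lemma prod_const (s : seq algC) (F : algC -> algC) c :
  {in s, forall z, F z = c} -> \prod_(z <- s) F z = c ^+ size s.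
Proof.
by move=> Fc; rewrite (eq_big_seq _ Fc) big_const_seq iter_mulr_1 count_predT.
Qed.

Lemma weilH_const_conjugates (x c : algC) : x \in Aint -> 1 <= c ->
  {in conjugates x, forall z, `|z| = c} -> weilH x = c.
Proof.
move=> Ax c1 Nx; have c0 := le_trans ler01 c1.
have Mc : mahler x = c ^+ alg_deg x.
  rewrite /mahler lead_minZ_Aint // mul1r -size_conjugates; apply: prod_const.
  move=> z /Nx zc; rewrite max1_norm zc; case: ifP => //.
  (* If [c] is not above 1, then it equals 1, the value of the maximum. *)
  by move: c1; rewrite le_eqVlt => /predU1P[<- | ->].
by rewrite weilHE Mc rootCpX ?alg_deg_gt0 // rootCK ?alg_deg_gt0.
Qed.

Lemma prod_le_const (s : seq algC) (F : algC -> algC) c :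
  {in s, forall z, 0 <= F z <= c} -> \prod_(z <- s) F z <= c ^+ size s.
Proof.
move=> Fc; rewrite -(@prod_const s (fun=> c)) // big_seq [leRHS]big_seq.
by apply: ler_prod => z; apply: Fc.
Qed.

Lemma weilH_weilH_le x : weilH (weilH x) <= weilH x.
Proof.
set y := weilH x; have y1 : 1 <= y := weilH_ge1 x; have y0 := le_trans ler01 y1.
have Hy0 := le_trans ler01 (weilH_ge1 y).
rewrite -(@ler_pXn2r _ (alg_deg y)) ?nnegrE ?alg_deg_gt0 //.
rewrite weilHX /mahler lead_minZ_Aint ?weilH_Aint // mul1r -size_conjugates.
apply: prod_le_const => z /norm_conjugates_weilH; rewrite -/y => zy.
rewrite (le_trans ler01 (max1_norm_ge1 z)) max1_norm.
by case: ifP.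
Qed.

(** * Fixed points of the height *)

Lemma weilH_fixed_max (y : algC) : weilH y = y ->
  {in conjugates y, forall z, Num.max 1 `|z| = y}.
Proof.
move=> fix_y z sz; have y1 : 1 <= y by rewrite -fix_y weilH_ge1.
have y0 : 0 < y := lt_le_trans ltr01 y1.
have max_le w : w \in conjugates y -> 0 <= Num.max 1 `|w| <= y.
  rewrite -{1}fix_y => /norm_conjugates_weilH; rewrite fix_y => wy.
  rewrite (le_trans ler01 (max1_norm_ge1 w)) max1_norm.
  by case: ifP.
have /andP[_] := max_le z sz; rewrite le_eqVlt => /predU1P[// | z_lt].
have := weilHX y; rewrite /mahler fix_y lead_minZ_Aint; last first.
  by rewrite -fix_y weilH_Aint.
rewrite mul1r (big_rem z sz) /= -size_conjugates => yd.
(* All factors are at most [y] and their product is the full power of [y], so a strictly smaller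
   factor at [z] is contradictory. *)
have : y ^+ size (conjugates y) < y ^+ size (conjugates y).
  rewrite {1}yd (perm_size (perm_to_rem sz)) /= exprS.
  apply: (@le_lt_trans _ _ (Num.max 1 `|z| * y ^+ size (rem z (conjugates y)))).
    rewrite ler_wpM2l //; first by case/andP: (max_le z sz).
    by apply: prod_le_const => w /mem_rem; apply: max_le.
  by rewrite ltr_pM2r // exprn_gt0.
by rewrite ltxx.
Qed.

Lemma weilH_fixed_natratpow (y : algC) : weilH y = y ->
  exists (a : nat) (b : rat), (0 < a)%N /\ 0 < b /\ y = natratpow a b.
Proof.
move=> fix_y; have y1 : 1 <= y by rewrite -fix_y weilH_ge1.
have Ay : y \in Aint by rewrite -fix_y weilH_Aint.
have y0 : 0 < y := lt_le_trans ltr01 y1.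
have max_y := weilH_fixed_max _ fix_y.
(* Only for [y] different from 1 does the maximum being [y] force |z| = y. *)
have [y_eq1 | y_neq1] := eqVneq y 1.
  by exists 1%N, 1; rewrite y_eq1 /natratpow /= expr1n rootC1.
have norm_y : {in conjugates y, forall z, `|z| = y}.
  move=> z /max_y; rewrite max1_norm; case: ifP => // _ y_eq1.
  by rewrite -y_eq1 eqxx in y_neq1.
pose d := alg_deg y; have d_gt0 : (0 < d)%N := alg_deg_gt0 y.
have normN : `|(minCpoly y)`_0| = y ^+ d.
  rewrite minCpoly_conjugates coef0_prod_XsubC normrM normrX normrN1 expr1n.
  by rewrite mul1r normr_prod (prod_const _ _ _ norm_y) size_conjugates.
(* The constant coefficient is the norm of [y] up to sign, an integer; its absolute value is the
   base [a], with exponent 1/d. *)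
have /natrP[a Da] : `|(minCpoly y)`_0| \in Num.nat.
  by rewrite natr_norm_int // (polyOverP Ay).
rewrite normN in Da.
exists a, (d%:R^-1); split; last split.
- by rewrite -(ltr0n algC) -Da exprn_gt0.
- by rewrite invr_gt0 ltr0n.
- have d_neq0 : d%:Z != 0 by rewrite -lt0n.
  have den_b : denq (d%:R^-1) = d by rewrite -[d%:R]/(d%:Z%:~R) denqVz.
  have num_b : numq (d%:R^-1) = 1.
    by apply: (@intr_inj rat); rewrite numqE den_b mulVf // pnatr_eq0 -lt0n.
  by rewrite /natratpow den_b num_b expr1 -Da rootCpX // ?rootCK // ltW.
Qed.

(** The [q]-th power of the number is a natural number, fixed by every automorphism, so all
    conjugates share its modulus. *)
Lemma weilH_natratpow (a : nat) (b : rat) : (0 < a)%N -> 0 < b ->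
  weilH (natratpow a b) = natratpow a b.
Proof.
move=> a_gt0 b_gt0; rewrite /natratpow.
set q := `|denq b|%N; set p := `|numq b|%N; set y := _.-root _.
have q_gt0 : (0 < q)%N by rewrite absz_gt0 denq_neq0.
have yq : y ^+ q = (a ^ p)%:R by rewrite rootCK // natrX.
have y1 : 1 <= y by rewrite rootC_ge1 // -natrX ler1n expn_gt0 a_gt0.
apply: weilH_const_conjugates => //.
  by rewrite (Aint_exp_inv _ _ q_gt0) // yq Aint_Cnat ?rpred_nat.
move=> _ /mem_conjugates[nu ->]; have y0 := le_trans ler01 y1.
apply: (pexpIrn q_gt0); rewrite ?nnegrE //.
by rewrite -normrX -rmorphXn /= yq rmorph_nat normr_nat.
Qed.

(** * Periodic points *)

Lemma weilH_iter_le n x : iter n.+1 weilH x <= weilH x.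
Proof.
elim: n => [|n IHn] //=; apply: le_trans IHn; exact: weilH_weilH_le.
Qed.

Theorem theorem9p1 :
  (forall (n : nat) (alpha : algC), (0 < n)%N -> iter n weilH alpha = alpha ->
     (exists (a : nat) (b : rat), (0 < a)%N /\ 0 < b /\ alpha = natratpow a b)
     /\ weilH alpha = alpha)
  /\ (forall (a : nat) (b : rat), (0 < a)%N -> 0 < b ->
        weilH (natratpow a b) = natratpow a b).
Proof.
split=> [[//|n] alpha _ periodic|]; last exact: weilH_natratpow.
have fix_alpha : weilH alpha = alpha.
  (* One bound reads [alpha] as an iterate starting from [weilH alpha]; the other uses that [alpha]
     is itself a value of [weilH]. *)
  apply/le_anti/andP; split; last by rewrite -{1}periodic weilH_iter_le.
  by rewrite -periodic /= weilH_weilH_le.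
by split=> //; apply: weilH_fixed_natratpow.
Qed.
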